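(* Let $s\ge 1$ be an integer. Then $$P(x,t)=\frac{\alpha(x,t)+\beta(x,t)\,tx\,P(tx,t)}{1-tx\,P(tx,t)},$$ where $$\alpha(x,t)=\sum_{n=0}^{s-1}C_{n}x^{n}-x^{s-1}\sum_{i=0}^{s-2}C_{s-2-i}\sum_{n=0}^{i}C_{n}(tx)^{n-i},$$ $$\beta(x,t)=-\sum_{n=0}^{s-2}C_{n}x^{n}+\frac{1}{t^{s-1}}\sum_{n=0}^{s-2}C_{n}(tx)^{n}.$$
   Context: For a word $w=w_1\cdots w_n$ of positive integers, its bargraph consists of $n$ consecutive columns of unit cells, aligned at the bottom, the $i$-th column having height $w_i$. An occurrence of a $1\times s$ rectangle in $w$ is a placement of a rectangle of height $1$ and width $s$ (with sides along the unit grid) inside the bargraph. Equivalently, the number of occurrences is $\sum_{i=1}^{n-s+1}\min\{w_i,\ldots,w_{i+s-1}\}$ (which is $0$ if $n<s$). A Catalan word of length $n$ is a word $w_1\cdots w_n$ of positive integers with $w_1=1$ and $w_{i+1}\le w_i+1$ for all $1\le i\le n-1$; $\mathcal{C}_n$ is the set of Catalan words of length $n$ ($\mathcal{C}_0$ contains only the empty word). $C_n=\frac{1}{n+1}\binom{2n}{n}$ is the $n$-th Catalan number. Let $p_n(t)=\sum_{w\in\mathcal{C}_n}t^{(\text{number of occurrences of } 1\times s\text{ rectangles in } w)}$ and $P(x,t)=\sum_{n\ge 0}p_n(t)x^n$. Empty sums are $0$. Identities are between formal power series in $x$ with coefficients in $\mathbb{Q}(t)$. *)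

(* Defs.v *)
(* [boolp] provides the eqType and choiceType structures of the power series
   and the extensionality of their coefficient functions. *)
From HB Require Import structures.
From mathcomp Require Import all_boot all_order all_algebra.
From mathcomp Require Import boolp.

Set Implicit Arguments.
Unset Strict Implicit.
Unset Printing Implicit Defensive.

Import GRing.Theory.
Local Open Scope ring_scope.

Record fps (K : fieldType) := Fps { fps_coef : nat -> K }.

Section Fps.
Variable K : fieldType.
Implicit Types f g h : fps K.

HB.instance Definition _ := gen_eqMixin (fps K).
HB.instance Definition _ := gen_choiceMixin (fps K).

Lemma fpsP f g : fps_coef f =1 fps_coef g <-> f = g.
Proof. by split=> [|->//]; case: f g => [a] [b] /= /funext ->. Qed.

Definition fps0 : fps K := Fps (fun=> 0).
Definition fps_opp f : fps K := Fps (fun n => - fps_coef f n).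
Definition fps_add f g : fps K := Fps (fun n => fps_coef f n + fps_coef g n).

Lemma fps_addA : associative fps_add.
Proof. by move=> f g h; apply/fpsP => n /=; rewrite addrA. Qed.
Lemma fps_addC : commutative fps_add.
Proof. by move=> f g; apply/fpsP => n /=; rewrite addrC. Qed.
Lemma fps_add0 : left_id fps0 fps_add.
Proof. by move=> f; apply/fpsP => n /=; rewrite add0r. Qed.
Lemma fps_addN : left_inverse fps0 fps_opp fps_add.
Proof. by move=> f; apply/fpsP => n /=; rewrite addNr. Qed.

HB.instance Definition _ :=
  GRing.isZmodule.Build (fps K) fps_addA fps_addC fps_add0 fps_addN.

Definition fps1 : fps K := Fps (fun n => (n == 0%N)%:R).
Definition fps_mul f g : fps K :=
  Fps (fun n => \sum_(i < n.+1) fps_coef f i * fps_coef g (n - i)).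

Definition fps_trunc n f : {poly K} := \poly_(i < n) fps_coef f i.

Lemma fps_mul_trunc f g n m : (n < m)%N ->
  fps_coef (fps_mul f g) n = (fps_trunc m f * fps_trunc m g)`_n.
Proof.
move=> nm; rewrite coefM /=; apply: eq_bigr => i _; rewrite !coef_poly.
have le_in : (i <= n)%N by rewrite -ltnS.
by rewrite (leq_ltn_trans le_in nm) (leq_ltn_trans (leq_subr i n) nm).
Qed.

Lemma fps_mulC : commutative fps_mul.
Proof.
by move=> f g; apply/fpsP => n; rewrite !(@fps_mul_trunc _ _ n n.+1) // mulrC.
Qed.

Lemma fps_mulA : associative fps_mul.
Proof.
have mulE3 f g h n : fps_coef (fps_mul (fps_mul f g) h) n =
    (fps_trunc n.+1 f * fps_trunc n.+1 g * fps_trunc n.+1 h)`_n.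
  rewrite coefM /=; apply: eq_bigr => i _.
  by rewrite -(@fps_mul_trunc f g) // coef_poly ltnS leq_subr.
move=> f g h; apply/fpsP => n.
by rewrite fps_mulC !mulE3 -(mulrA (fps_trunc n.+1 f)) (mulrC (fps_trunc _ f)).
Qed.

Lemma fps_mul1 : left_id fps1 fps_mul.
Proof.
move=> f; apply/fpsP => n /=; rewrite big_ord_recl /= mul1r subn0.
by rewrite big1 ?addr0 // => i _; rewrite mul0r.
Qed.

Lemma fps_mulDl : left_distributive fps_mul +%R.
Proof.
move=> f g h; apply/fpsP => n /=; rewrite -big_split /=.
by apply: eq_bigr => i _; rewrite mulrDl.
Qed.

Lemma fps1_neq0 : fps1 != 0.
Proof. by apply/eqP => /fpsP /(_ 0%N) /eqP; rewrite /= oner_eq0. Qed.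

HB.instance Definition _ := GRing.Zmodule_isComNzRing.Build (fps K)
  fps_mulA fps_mulC fps_mul1 fps_mulDl fps1_neq0.

Definition fps_scale (a : K) f : fps K := Fps (fun n => a * fps_coef f n).

Lemma fps_scaleA a b f : fps_scale a (fps_scale b f) = fps_scale (a * b) f.
Proof. by apply/fpsP => n /=; rewrite mulrA. Qed.
Lemma fps_scale1 : left_id 1 fps_scale.
Proof. by move=> f; apply/fpsP => n /=; rewrite mul1r. Qed.
Lemma fps_scaleDr : right_distributive fps_scale +%R.
Proof. by move=> a f g; apply/fpsP => n /=; rewrite mulrDr. Qed.
Lemma fps_scaleDl f : {morph fps_scale^~ f : a b / a + b}.
Proof. by move=> a b; apply/fpsP => n /=; rewrite mulrDl. Qed.

HB.instance Definition _ := GRing.Zmodule_isLmodule.Build K (fps K)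
  fps_scaleA fps_scale1 fps_scaleDr fps_scaleDl.

Lemma fps_scaleAl (a : K) f g : a *: (f * g) = (a *: f) * g.
Proof.
apply/fpsP => n /=; rewrite mulr_sumr.
by apply: eq_bigr => i _; rewrite mulrA.
Qed.

HB.instance Definition _ :=
  GRing.Lmodule_isLalgebra.Build K (fps K) fps_scaleAl.
HB.instance Definition _ := GRing.Lalgebra_isComAlgebra.Build K (fps K).

(* The first n coefficients of 1 / f, from the recursion
   f_0 g_n = (n == 0) - \sum_(i < n) f_(n - i) g_i. *)
Fixpoint fps_inv_seq f (n : nat) : seq K :=
  if n is m.+1 then
    let s := fps_inv_seq f m in
    rcons s (((m == 0%N)%:R - \sum_(i < m) fps_coef f (m - i) * s`_i)
              / fps_coef f 0)
  else [::].

Definition fps_unit : {pred fps K} := [pred f | fps_coef f 0 != 0].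
Definition fps_inv f : fps K :=
  if f \in fps_unit then Fps (fun n => (fps_inv_seq f n.+1)`_n) else f.

Lemma size_fps_inv_seq f n : size (fps_inv_seq f n) = n.
Proof. by elim: n => //= n IHn; rewrite size_rcons IHn. Qed.

Lemma nth_fps_inv_seq f n m : (m < n)%N ->
  (fps_inv_seq f n)`_m = (fps_inv_seq f m.+1)`_m.
Proof.
elim: n => // n IHn; rewrite ltnS leq_eqVlt => /predU1P[-> //|lt_mn].
by rewrite [fps_inv_seq f n.+1]/= nth_rcons size_fps_inv_seq lt_mn IHn.
Qed.

Lemma fps_mulV : {in fps_unit, left_inverse 1 fps_inv *%R}.
Proof.
move=> f uf; rewrite /fps_inv uf; apply/fpsP => n.
have f0 : fps_coef f 0 != 0 by [].
rewrite [LHS]/= big_ord_recr /= subnn.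
rewrite nth_rcons size_fps_inv_seq ltnn eqxx divfK //.
rewrite [X in _ + (_ - X)](eq_bigr (fun i : 'I_n =>
  (fps_inv_seq f i.+1)`_i * fps_coef f (n - i))); last first.
  by move=> i _; rewrite nth_fps_inv_seq // mulrC.
by rewrite addrC subrK.
Qed.

Lemma fps_unitPl f g : g * f = 1 -> f \in fps_unit.
Proof.
move=> /fpsP /(_ 0%N) /=; rewrite big_ord1 => gf1.
by apply/eqP => f0; move/eqP: gf1; rewrite f0 mulr0 eq_sym oner_eq0.
Qed.

Lemma fps_inv_out : {in [predC fps_unit], fps_inv =1 id}.
Proof. by move=> f; rewrite inE /= /fps_inv => /negPf ->. Qed.

HB.instance Definition _ := GRing.ComNzRing_hasMulInverse.Build (fps K)
  fps_mulV fps_unitPl fps_inv_out.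

Lemma fps_unitE f : (f \is a GRing.unit) = (fps_coef f 0 != 0).
Proof. by []. Qed.

Definition fps_var : fps K := Fps (fun n => (n == 1%N)%:R).

(* The substitution f(x) |-> f(c x). *)
Definition fps_dilate (c : K) f : fps K :=
  Fps (fun n => c ^+ n * fps_coef f n).

End Fps.

Notation Qt := {fraction {poly rat}}.
Definition tvar : Qt := tofrac 'X.
Definition xvar : fps Qt := fps_var Qt.

Definition catalan (n : nat) : Qt := 'C(n.*2, n)%:R / n.+1%:R.

(* The default value 1 of [head] makes the empty word a Catalan word. *)
Definition catalan_word (w : seq nat) : bool :=
  [&& all (fun a => 0 < a)%N w, head 1%N w == 1%N
    & sorted (fun a b => b <= a.+1)%N w].

(* A placement is given by its leftmost column i and its row h (both counted
   from 0): the cell of row h in column j lies in the bargraph iff h < w_j. *)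
Definition occ (s : nat) (w : seq nat) : nat :=
  #|[set p : 'I_(size w) * 'I_(\max_(a <- w) a) |
      (p.1 + s <= size w)%N && [forall j : 'I_s, p.2 < nth 0 w (p.1 + j)]%N]|.

Lemma ltn_bigminn h a (r : seq nat) (F : nat -> nat) :
  (h < \big[minn/a]_(j <- r) F j)%N = (h < a)%N && all (fun j => h < F j)%N r.
Proof.
elim: r => [|j r IHr]; first by rewrite big_nil andbT.
by rewrite big_cons leq_min IHr /= andbCA.
Qed.

Lemma occE s w : (0 < s)%N ->
  occ s w = (\sum_(i < (size w).+1 - s)
    \big[minn/nth 0 w i]_(i <= j < i + s) nth 0 w j)%N.
Proof.
move=> s_gt0; pose m i := (\big[minn/nth 0 w i]_(i <= j < i + s) nth 0 w j)%N.
have le_n : ((size w).+1 - s <= size w)%N by rewrite leq_subLR -add1n leq_add2r.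
have ltE i : (i < (size w).+1 - s)%N = (i + s <= size w)%N.
  by rewrite ltn_subRL addnC ltnS.
have mE h i : (h < m i)%N = [forall j : 'I_s, h < nth 0 w (i + j)]%N.
  rewrite /m ltn_bigminn; apply/andP/forallP => [[_ /allP hm] j | hm].
    by apply: hm; rewrite mem_index_iota leq_addr ltn_add2l ltn_ord.
  split; first by have := hm (Ordinal s_gt0); rewrite addn0.
  apply/allP => j; rewrite mem_index_iota => /andP[le_ij lt_j].
  have lt_js : (j - i < s)%N by rewrite ltn_subLR.
  by have := hm (Ordinal lt_js); rewrite /= subnKC.
have m_le (i : 'I_(size w)) : (m i <= \max_(a <- w) a)%N.
  rewrite leqNgt mE; apply/negP => /forallP /(_ (Ordinal s_gt0)).
  have wi : nth 0%N w i \in w by rewrite mem_nth.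
  by rewrite addn0 ltnNge (@leq_bigmax_seq _ w xpredT id _ wi).
rewrite (big_ord_widen_cond _ xpredT m le_n) /occ -sum1_card.
under eq_bigl do rewrite inE.
rewrite -(pair_big_dep (fun i : 'I_(size w) => i + s <= size w)%N
  (fun i (h : 'I_(\max_(a <- w) a)) =>
    [forall j : 'I_s, h < nth 0 w (i + j)]%N) (fun _ _ => 1%N)) /=.
apply: eq_big => [i | i _]; first by rewrite ltE.
under eq_bigl do rewrite -mE.
rewrite (@big_ord_narrow _ _ _ _ _ (fun=> 1%N) (m_le i)).
by rewrite sum_nat_const card_ord muln1.
Qed.

(* The letters of a Catalan word of length n are at most n, so words are
   encoded as n-tuples over 'I_n.+1. *)
Definition word_of n (w : n.-tuple 'I_n.+1) : seq nat := map val w.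

Definition catalan_words n : {set n.-tuple 'I_n.+1} :=
  [set w | catalan_word (word_of w)].

Lemma word_of_inj n : injective (@word_of n).
Proof. by move=> u v /(inj_map val_inj) /val_inj. Qed.

Lemma catalan_word_le (w : seq nat) :
  catalan_word w -> {in w, forall a, a <= size w}%N.
Proof.
case: w => [|b w] // /and3P[_ /= /eqP -> w_path].
have pathP k c (v : seq nat) : path (fun a b => b <= a.+1)%N c v ->
    (c <= k)%N -> {in c :: v, forall a, a <= k + size v}%N.
  elim: v k c => [|d v IHv] k c /=.
    by move=> _ ck a; rewrite inE addn0 => /eqP ->.
  move=> /andP[dc /IHv v_le] ck a; rewrite inE => /predU1P[->|/v_le].
    exact: leq_trans ck (leq_addr _ _).
  by rewrite addnS -addSn; apply; apply: leq_trans dc _.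
by have := pathP 1%N 1%N w w_path isT; rewrite add1n.
Qed.

Lemma catalan_wordsP n (w : seq nat) :
  reflect (exists2 u, u \in catalan_words n & word_of u = w)
          ((size w == n) && catalan_word w).
Proof.
apply: (iffP andP) => [[/eqP sz_w cw] | [u]]; last first.
  by rewrite inE => cu <-; rewrite size_map size_tuple.
have sz : size (map (@inord n) w) == n by rewrite size_map sz_w.
have uE : word_of (Tuple sz) = w.
  rewrite /word_of /= -map_comp map_id_in // => a /(catalan_word_le cw).
  by rewrite sz_w => le_an /=; rewrite inordK.
by exists (Tuple sz); rewrite // inE uE.
Qed.

Definition occ_poly (s n : nat) : Qt :=
  \sum_(w in catalan_words n) tvar ^+ occ s (word_of w).

Definition occ_series (s : nat) : fps Qt := Fps (occ_poly s).

(* The factor x^(s-1) is distributed over the inner sums: since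
   n <= i <= s-2, x^(s-1) (t x)^(n-i) = t^-(i-n) x^(s-1-(i-n)). *)
Definition alpha (s : nat) : fps Qt :=
  \sum_(0 <= n < s) catalan n *: xvar ^+ n
  - \sum_(0 <= i < s.-1) catalan (s - 2 - i) *:
      \sum_(0 <= n < i.+1)
        (catalan n * tvar ^- (i - n)) *: xvar ^+ (s.-1 - (i - n)).

Definition beta (s : nat) : fps Qt :=
  - \sum_(0 <= n < s.-1) catalan n *: xvar ^+ n
  + tvar ^- s.-1 *: \sum_(0 <= n < s.-1) catalan n *: (tvar *: xvar) ^+ n.

(* Main.v *)
Require Import Defs.
From mathcomp Require Import all_boot all_order all_algebra.
From mathcomp Require Import zify ring.

Import GRing.Theory.
Local Open Scope ring_scope.

(** Cut the bargraph of a Catalan word w of length n along its bottom row.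
    A bottom row of length n carries (n - (s - 1))^+ rectangles of size 1 x s.
    Above it, the columns of height 1 have disappeared; since w starts with 1
    and climbs by at most 1 at a time, what remains is a sequence of bargraphs
    of Catalan words separated by these empty columns, and no rectangle
    crosses an empty column.  Let q_n be the generating polynomial of the
    rectangles above the bottom row (above_poly) and let Q(x) be the series
    of the q_n.  The first-return decomposition w = 1 (u + 1) v, where u and v
    are Catalan words, gives
<<
      q_0 = 1,  q_(n+1) = p_0 q_n + ... + p_n q_0,  i.e.  (1 - x P) Q = 1,
>>
    (above_polyS, above_series_inv), while the bottom row gives
    p_n = t^((n - (s - 1))^+) q_n (occ_poly_bottom).

    Without truncation the last relation would read P(x) = t^-(s-1) Q(t x).
    It is wrong only for n < s - 1, where p_n = q_n is the Catalan number C_n,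
    and subtracting beta corrects exactly these coefficients:
    P(x) = t^-(s-1) Q(t x) - beta (occ_series_above).  That p_n = C_n for n < s needs no enumeration of the
    Catalan words: there q_n = p_n, so the recurrence above becomes the Catalan
    recurrence (occ_poly_catalan).

    Multiplying by 1 - D with D = t x P(t x), one gets
    (1 - D) P = t^-(s-1) - (1 - D) beta, and this is alpha + beta D because
    alpha + beta = t^-(s-1) (alphaD_beta): by the Catalan recurrence, the double
    sum in alpha collapses to a sum of the C_m t^(m-s+1) x^m over 0 < m < s.

    The width s is positive and is written k.+1, so k is s - 1. *)

(** * Rectangles in a bargraph *)

(** The minimum of the first k+1 letters of w, and 0 if w is shorter.  By this
    default, every suffix of a word can be treated as the start of a window, and
    the number of occurrences becomes a sum over all suffixes, which suits
    induction on the word. *)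
Fixpoint min_prefix (k : nat) (w : seq nat) {struct w} : nat :=
  match w, k with
  | [::], _ => 0
  | a :: _, 0 => a
  | a :: w', k'.+1 => minn a (min_prefix k' w')
  end.

Lemma min_prefixE (k : nat) (w : seq nat) :
  min_prefix k w = \big[minn/nth 0 w 0]_(0 <= j < k.+1) nth 0 w j.
Proof.
(* Both sides have the same strict lower bounds. *)
have ltE h : (h < min_prefix k w)%N = all (fun j => h < nth 0 w j)%N (iota 0 k.+1).
  elim: k w => [|k IHk] [|a w] //=; first by rewrite andbT.
  by rewrite leq_min IHk (iotaDl 1 1) all_map.
set m := RHS.
have ltE' h : (h < m)%N = (h < min_prefix k w)%N.
  rewrite /m ltn_bigminn ltE /index_iota subn0 andb_idl //= => /andP[] //.
apply/eqP; rewrite eqn_leq; apply/andP; split; rewrite leqNgt ?ltE' ?ltnn //.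
by rewrite -ltE' ltnn.
Qed.

Lemma min_prefix_short (k : nat) (w : seq nat) :
  (size w <= k)%N -> min_prefix k w = 0%N.
Proof. by elim: k w => [|k IHk] [|a w] //= /IHk ->; rewrite minn0. Qed.

Lemma occ_sum_min_prefix (k : nat) (w : seq nat) :
  occ k.+1 w = (\sum_(i < size w) min_prefix k (drop i w))%N.
Proof.
rewrite occE // subSS.
rewrite [LHS](eq_bigr (fun i : 'I_ _ => min_prefix k (drop i w))) => [|i _].
  rewrite [RHS](bigID (fun i : 'I__ => i < size w - k)%N) /= [X in (_ + X)%N]big1.
    rewrite addn0 (big_ord_narrow (F := fun i => min_prefix k (drop i w)))//.
    exact: leq_subr.
  move=> i; rewrite -leqNgt => le_i; apply: min_prefix_short.
  by rewrite size_drop; have := ltn_ord i; lia.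
rewrite min_prefixE nth_drop addn0 -{2}[nat_of_ord i]add0n big_addn addKn.
by apply: eq_bigr => j _; rewrite nth_drop addnC.
Qed.

Lemma occ_nil (k : nat) : occ k.+1 [::] = 0%N.
Proof. by rewrite occ_sum_min_prefix big_ord0. Qed.

Lemma occ_cons (k a : nat) (w : seq nat) :
  occ k.+1 (a :: w) = (min_prefix k (a :: w) + occ k.+1 w)%N.
Proof. by rewrite !occ_sum_min_prefix /= big_ord_recl. Qed.

Lemma min_prefix_cat0 (k : nat) (u v : seq nat) :
  min_prefix k (u ++ 0%N :: v) = min_prefix k u.
Proof.
elim: u k => [|a u IHu] [|k] //=; first by rewrite min0n.
by rewrite IHu.
Qed.

(** A window that meets an empty column has minimum 0, so an empty column splits
    a bargraph into two independent parts. *)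
Lemma occ_cat0 (k : nat) (u v : seq nat) :
  occ k.+1 (u ++ 0%N :: v) = (occ k.+1 u + occ k.+1 v)%N.
Proof.
elim: u => [|a u IHu].
  by rewrite occ_cons -[_ :: v]cat0s min_prefix_cat0 occ_nil.
by rewrite cat_cons !occ_cons -cat_cons min_prefix_cat0 IHu addnA.
Qed.

(** Removing the bottom row lowers by 1 the minimum of a complete window; an
    incomplete one has minimum 0 before and after. *)
Lemma min_prefix_bottom (k : nat) (w : seq nat) :
  all (fun a => 0 < a)%N w ->
  min_prefix k w = ((k < size w) + min_prefix k (map predn w))%N.
Proof.
elim: w k => [|[|a] w IHw] [|k] //= /IHw IHk.
rewrite IHk; case: (ltnP k _) => [|lek]; last rewrite min_prefix_short ?size_map //;
  lia.
Qed.

(** In truncated subtraction, [size w - k] is the number of windows of width k+1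
    of a word of any length, hence of rectangles in the bottom row. *)
Lemma occ_bottom (k : nat) (w : seq nat) :
  all (fun a => 0 < a)%N w ->
  occ k.+1 w = ((size w - k) + occ k.+1 (map predn w))%N.
Proof.
elim: w => [|a w IHw] w_gt0; first by rewrite occ_nil.
rewrite [map _ _]/= !occ_cons (min_prefix_bottom k (a :: w)) // IHw.
  rewrite /=; lia.
by case/andP: w_gt0.
Qed.

(** * First-return decomposition of Catalan words *)

(** Enumerating the Catalan words as plain sequences makes words of different
    lengths live in one type, as concatenation requires. *)
Definition words (n : nat) : seq (seq nat) :=
  [seq word_of w | w <- enum (catalan_words n)].

Lemma words_uniq (n : nat) : uniq (words n).
Proof. by rewrite map_inj_uniq ?enum_uniq //; apply: word_of_inj. Qed.

Lemma mem_words (n : nat) (w : seq nat) :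
  (w \in words n) = (size w == n) && catalan_word w.
Proof.
apply/mapP/catalan_wordsP => [[u u_in ->]|[u u_in <-]]; exists u => //;
  by rewrite mem_enum in u_in *.
Qed.

Lemma big_words (n : nat) (F : seq nat -> Qt) :
  \sum_(w in catalan_words n) F (word_of w) = \sum_(w <- words n) F w.
Proof. by rewrite big_map big_enum. Qed.

Lemma words0 : words 0 = [:: [::]].
Proof.
apply: perm_small_eq => //; apply: uniq_perm; rewrite ?words_uniq // => w.
rewrite mem_words inE -[w == [::]]/(w == [::]); case: w => //.
Qed.

(** The Dyck path read off a Catalan word, whose letters are the heights reached
    by its up steps, decomposes at its first return to the axis: the letters
    before the second 1 of the word are 1 followed by a Catalan word raised by
    1. *)
Definition first_return (u v : seq nat) : seq nat := 1%N :: map S u ++ v.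

Lemma catalan_word_cons (a : nat) (w : seq nat) :
  catalan_word (a :: w) =
  [&& a == 1%N, all (fun a => 0 < a)%N w & path (fun a b => b <= a.+1)%N a w].
Proof. by rewrite /catalan_word /=; case: a => [|[|a]] //=; rewrite andbF. Qed.

Lemma path_map_S (a : nat) (w : seq nat) :
  path (fun a b => b <= a.+1)%N a.+1 (map S w) =
  path (fun a b => b <= a.+1)%N a w.
Proof. by elim: w a => //= b w IHw a; rewrite ltnS IHw. Qed.

Lemma catalan_first_return (u v : seq nat) :
  catalan_word u -> catalan_word v -> catalan_word (first_return u v).
Proof.
move=> cu cv; rewrite /first_return catalan_word_cons /= all_cat cat_path.
have -> /= : all (fun a => 0 < a)%N (map S u) by apply/allP => _ /mapP[b _ ->].
have -> /= : all (fun a => 0 < a)%N v by case/and3P: cv.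
apply/andP; split.
  case: u cu => // b u; rewrite catalan_word_cons => /and3P[/eqP -> _].
  by rewrite /= path_map_S.
by case: v cv => // b v; rewrite catalan_word_cons => /and3P[/eqP -> _ /= ->].
Qed.

(** The letters of [map S u] exceed 1 while v is empty or starts with 1, so the
    boundary between them can be read off the word. *)
Lemma first_return_inj (u v u' v' : seq nat) :
  all (fun a => 0 < a)%N u -> all (fun a => 0 < a)%N u' ->
  head 1%N v = 1%N -> head 1%N v' = 1%N ->
  first_return u v = first_return u' v' -> u = u' /\ v = v'.
Proof.
move=> u_gt0 u'_gt0 v1 v'1 [].
elim: u u' u_gt0 u'_gt0 => [|[|b] u IHu] [|[|b'] u'] //= u_gt0 u'_gt0.
- by move=> Ev; rewrite Ev in v1.
- by move=> Ev'; rewrite -Ev' in v'1.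
by move=> [-> /IHu[] // -> ->].
Qed.

Lemma first_return_surj (w : seq nat) : catalan_word w -> w != [::] ->
  exists u v, [/\ catalan_word u, catalan_word v & w = first_return u v].
Proof.
have split_ones r : all (fun a => 0 < a)%N r -> exists u v,
    [/\ all (fun a => 0 < a)%N u, head 1%N v = 1%N & r = map S u ++ v].
  elim: r => [|[|[|b]] r IHr] //=; first by exists [::], [::].
    by exists [::], (1%N :: r).
  by move=> /IHr[u [v [u_gt0 v1 ->]]]; exists (b.+1 :: u), v.
case: w => // a r; rewrite catalan_word_cons => /and3P[/eqP -> r_gt0 r_path] _.
have [u [v [u_gt0 v1 Er]]] := split_ones r r_gt0; exists u, v; split.
- move: r_path; rewrite Er cat_path => /andP[+ _] {Er}.
  case: u u_gt0 => [|[|b] u] // u_gt0 /=; case: b u_gt0 => //= u_gt0.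
  by rewrite path_map_S catalan_word_cons => ->; rewrite u_gt0.
- move: r_path r_gt0; rewrite Er cat_path all_cat => /andP[_ +] /andP[_ +] {Er}.
  case: v v1 => //= b v -> /andP[_ v_path] v_gt0.
  by rewrite catalan_word_cons; case/andP: v_gt0 => _ ->.
by rewrite Er.
Qed.

(** The bijection behind the Catalan recurrence, at the level of enumerations so
    that sums over words can be rewritten along it. *)
Lemma words_first_return (n : nat) :
  perm_eq (words n.+1)
    [seq first_return p.1 p.2 | i <- iota 0 n.+1,
       p <- [seq (u, v) | u <- words i, v <- words (n - i)]].
Proof.
apply: uniq_perm; first exact: words_uniq.
  apply: allpairs_uniq_dep; first exact: iota_uniq.
    by move=> i _; apply: allpairs_uniq; rewrite ?words_uniq // => -[? ?] [? ?].
  move=> _ _ /allpairsPdep[i [p [_ p_in ->]]] /allpairsPdep[j [q [_ q_in ->]]] /=.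
  have {p_in} /allpairsP[[u v] /= [+ + ->]] := p_in.
  have {q_in} /allpairsP[[u' v'] /= [+ + ->]] := q_in.
  rewrite !mem_words => /andP[/eqP su' /and3P[u'_gt0 _ _]].
  move=> /andP[_ /and3P[_ /eqP v'1 _]] /andP[/eqP su /and3P[u_gt0 _ _]].
  move=> /andP[_ /and3P[_ /eqP v1 _]] /first_return_inj[] // Eu Ev.
  by rewrite -su -su' Eu Ev.
move=> w; rewrite mem_words; apply/idP/allpairsPdep.
  move=> /andP[/eqP sz /first_return_surj[|u [v [cu cv Ew]]]]; first by case: w sz.
  have suv : (size u + size v = n)%N.
    by move: sz; rewrite Ew /= size_cat size_map => -[].
  exists (size u), (u, v); split=> //.
    by rewrite mem_iota ltnS -suv leq_addr.
  by apply/allpairsP; exists (u, v); rewrite !mem_words cu cv -suv addKn !eqxx.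
move=> [i [p [+ /allpairsP[[u v] /= [+ + ->]] ->]]] /=.
rewrite mem_iota !mem_words ltnS => /= le_i /andP[/eqP su cu] /andP[/eqP sv cv].
by rewrite catalan_first_return // size_cat size_map su sv subnKC // eqxx.
Qed.

(** * Rectangles above the bottom row *)

(** Lowering every letter by 1 deletes the bottom row, so these are the
    polynomials q_n counting the rectangles that lie above it. *)
Definition above_poly (s n : nat) : Qt :=
  \sum_(w <- words n) tvar ^+ occ s (map predn w).

Lemma above_poly0 (k : nat) : above_poly k.+1 0 = 1.
Proof. by rewrite /above_poly words0 big_seq1 occ_nil. Qed.

Lemma occ_poly_bottom (k n : nat) :
  occ_poly k.+1 n = tvar ^+ (n - k) * above_poly k.+1 n.
Proof.
rewrite /occ_poly (big_words n (fun w => tvar ^+ occ k.+1 w)) mulr_sumr.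
apply: eq_big_seq => w; rewrite mem_words => /andP[/eqP <- /and3P[w_gt0 _ _]].
by rewrite occ_bottom // exprD.
Qed.

(** Lowered by 1, the word 1 (u + 1) v is 0 u (v - 1), and v - 1 is empty or
    starts with 0: either u ends the word or an empty column, which no rectangle
    crosses, follows it. *)
Lemma occ_above_first_return (k : nat) (u v : seq nat) : head 1%N v = 1%N ->
  occ k.+1 (map predn (first_return u v)) =
  (occ k.+1 u + occ k.+1 (map predn v))%N.
Proof.
have -> : map predn (first_return u v) = [::] ++ 0%N :: (u ++ map predn v).
  by rewrite /= map_cat (mapK succnK).
rewrite occ_cat0 occ_nil add0n; case: v => [|b v /= ->] /=.
  by rewrite cats0 occ_nil addn0.
by rewrite occ_cat0 -[_ :: _]cat0s occ_cat0 occ_nil.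
Qed.

Lemma above_polyS (k n : nat) :
  above_poly k.+1 n.+1 =
  \sum_(i < n.+1) occ_poly k.+1 i * above_poly k.+1 (n - i).
Proof.
rewrite /above_poly (perm_big _ (words_first_return n)) big_allpairs_dep.
rewrite -[iota 0 n.+1]/(index_iota 0 n.+1) big_mkord.
apply: eq_bigr => i _.
rewrite /occ_poly (big_words i (fun w => tvar ^+ occ k.+1 w)) big_allpairs.
rewrite mulr_suml.
apply: eq_bigr => u _; rewrite mulr_sumr.
apply: eq_big_seq => v; rewrite mem_words => /andP[_ /and3P[_ /eqP v1 _]].
by rewrite occ_above_first_return // exprD.
Qed.

(** * Catalan numbers *)

Lemma natr_Qt_eq0 (n : nat) : (n%:R == 0 :> Qt) = (n == 0)%N.
Proof.
rewrite -[n%:R](rmorph_nat (@tofrac _)) tofrac_eq0 -polyC_natr polyC_eq0.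
exact: Num.Theory.pnatr_eq0.
Qed.

Lemma tvar_neq0 : tvar != 0.
Proof. by rewrite tofrac_eq0 polyX_eq0. Qed.

Lemma catalan0 : catalan 0 = 1.
Proof. by rewrite /catalan bin0 divr1. Qed.

Lemma catalanS (n : nat) : n.+2%:R * catalan n.+1 = (4 * n + 2)%:R * catalan n.
Proof.
have n1 m : m.+1%:R != 0 :> Qt by rewrite natr_Qt_eq0.
have binS : (n.+1 * 'C(n.+1.*2, n.+1) = (4 * n + 2) * 'C(n.*2, n))%N.
  have := mul_bin_diag n.+1.*2 n; have := mul_bin_down n.*2.+1 n.
  by rewrite doubleS /= -addnn; nia.
rewrite /catalan [LHS]mulrC divfK ?n1 //.
apply: (mulfI (n1 n)).
by rewrite -natrM binS mulrCA [n.+1%:R * _]mulrC divfK ?n1 // natrM.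
Qed.

(** Let S_m be the convolution and T_m the same sum weighted by i + 1.  The
    symmetry exchanging i and m - i gives 2 T_m = (m + 2) S_m, and replacing
    (i + 2) C_(i+1) by (4 i + 2) C_i in T_(m+1) expresses it by T_m and S_m.
    Together these give the two-term recurrence of S, which is that of the
    Catalan numbers shifted by one. *)
Lemma catalan_rec (n : nat) :
  catalan n.+1 = \sum_(i < n.+1) catalan i * catalan (n - i).
Proof.
pose S m : Qt := \sum_(i < m.+1) catalan i * catalan (m - i).
pose T m : Qt := \sum_(i < m.+1) i.+1%:R * (catalan i * catalan (m - i)).
have n1 m : m.+1%:R != 0 :> Qt by rewrite natr_Qt_eq0.
have T2 m : 2%:R * T m = m.+2%:R * S m.
  have TE : T m = \sum_(i < m.+1) (m - i).+1%:R * (catalan i * catalan (m - i)).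
    rewrite /T (reindex_inj rev_ord_inj) /=; apply: eq_bigr => i _.
    by rewrite subSS subKn ?leq_ord // [catalan i * _]mulrC.
  rewrite mulr2n mulrDl mul1r {2}TE -big_split mulr_sumr /=.
  apply: eq_bigr => i _; rewrite -mulrDl -natrD; congr (_ * _); congr (_%:R).
  by have := leq_ord i; lia.
have TS m : T m.+1 = catalan m.+1 + (m.*2.+2)%:R * S m.
  have -> : m.*2.+2%:R * S m = 2%:R * (2%:R * T m) - 2%:R * S m.
    by rewrite T2 -mul2n; ring.
  rewrite /T big_ord_recl /= mul1r catalan0 mul1r subn0; congr (_ + _).
  rewrite !mulr_sumr -sumrB; apply: eq_bigr => i _.
  by rewrite /bump subSS add1n mulrA catalanS; ring.
rewrite -/(S n); elim: n => [|n IHn].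
  rewrite /S big_ord1 catalan0 mul1r; apply: (mulfI (n1 1)).
  by rewrite catalanS catalan0.
apply: (mulfI (n1 n.+2)); rewrite -T2 TS -IHn catalanS.
by rewrite -mul2n; ring.
Qed.

(** * Power series *)

Lemma fps_coef_sum (K : fieldType) (I : Type) (r : seq I) (P : pred I)
    (F : I -> fps K) (n : nat) :
  fps_coef (\sum_(i <- r | P i) F i) n = \sum_(i <- r | P i) fps_coef (F i) n.
Proof. by apply: (big_morph (fun f => fps_coef f n)). Qed.

Lemma fps_coef_varM (K : fieldType) (f : fps K) (n : nat) :
  fps_coef (fps_var K * f) n = if n is m.+1 then fps_coef f m else 0.
Proof.
case: n => [|n] /=; rewrite big_ord_recl /= mul0r add0r ?big_ord0 //.
rewrite big_ord_recl /= mul1r subSS subn0 big1 ?addr0 // => i _.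
by rewrite mul0r.
Qed.

Lemma fps_coef_varX (K : fieldType) (m n : nat) :
  fps_coef (fps_var K ^+ m) n = (n == m)%:R.
Proof.
elim: m n => [|m IHm] [|n] //; rewrite exprS fps_coef_varM ?IHm //.
Qed.

Lemma fps_coef_sum_varX (K : fieldType) (c : nat -> K) (k n : nat) :
  fps_coef (\sum_(0 <= m < k) c m *: fps_var K ^+ m) n =
  if (n < k)%N then c n else 0.
Proof.
rewrite fps_coef_sum; under eq_bigr => m _ do rewrite /= fps_coef_varX.
case: ltnP => [lt_nk|le_kn].
  rewrite big_mkord (bigD1 (Ordinal lt_nk)) //= eqxx mulr1 big1 ?addr0 // => m.
  by rewrite -val_eqE /= eq_sym => /negPf ->; rewrite mulr0.
rewrite big_nat big1 // => m /andP[_ lt_mk].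
by rewrite gtn_eqF ?mulr0 // (leq_trans lt_mk).
Qed.

(** * The coefficients alpha and beta *)

(** Summation of a triangle along its diagonals. *)
Lemma sum_triangle (V : nmodType) (F : nat -> nat -> V) (N : nat) :
  \sum_(0 <= i < N) \sum_(0 <= n < i.+1) F (i - n)%N n =
  \sum_(0 <= j < N) \sum_(0 <= n < N - j) F j n.
Proof.
elim: N => [|N IHN]; first by rewrite !big_geq.
rewrite big_nat_recr // IHN [RHS]big_nat_recr //= subSnn big_nat1.
rewrite [X in _ = X + _](eq_big_nat _ _ (F2 := fun j =>
  \sum_(0 <= n < N - j) F j n + F j (N - j)%N)); last first.
  by move=> j /andP[_ lt_jN]; rewrite subSn 1?ltnW // big_nat_recr.
rewrite big_split /= -addrA; congr (_ + _).
rewrite big_nat_rev /= big_nat_recr //= add0n subnn subn0; congr (_ + _).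
by apply: eq_big_nat => j /andP[_ lt_jN]; rewrite subSS subKn 1?ltnW.
Qed.

(** The double sum in alpha depends on (i, n) through i - n and a product of two
    Catalan numbers; along a diagonal i - n = j, the products add up to
    C_(k-j).  What remains are two sums of the terms [G n] below, over 0 < n <= k
    in alpha and over 0 <= n < k in beta, which differ by their end terms: [G k]
    cancels the last term of the first sum in alpha and [G 0] is the result. *)
Lemma alphaD_beta (k : nat) : alpha k.+1 + beta k.+1 = tvar ^- k *: 1.
Proof.
rewrite /alpha /beta /= big_nat_recr //=.
pose F j n : fps Qt :=
  (catalan (k.-1 - j - n) * catalan n) *: (tvar ^- j *: xvar ^+ (k - j)).
have -> : \sum_(0 <= i < k) catalan (k.+1 - 2 - i) *:
      \sum_(0 <= n < i.+1) (catalan n * tvar ^- (i - n)) *: xvar ^+ (k - (i - n))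
   = \sum_(0 <= m < k) (catalan m.+1 * tvar ^- (k - m.+1)) *: xvar ^+ m.+1.
  transitivity (\sum_(0 <= i < k) \sum_(0 <= n < i.+1) F (i - n)%N n).
    apply: eq_big_nat => i _; rewrite scaler_sumr; apply: eq_big_nat => n.
    rewrite ltnS => /andP[_ le_ni]; rewrite /F !scalerA mulrA.
    by congr (catalan _ * _ * _ *: _); lia.
  rewrite sum_triangle big_nat_rev; apply: eq_big_nat => m /andP[_ lt_mk].
  rewrite add0n /F -scaler_suml scalerA subKn //.
  congr (_ * _ *: _); rewrite catalan_rec big_mkord; apply: eq_bigr => i _.
  by rewrite mulrC; congr (_ * catalan _); lia.
have tX n : (n <= k)%N -> tvar ^- k * tvar ^+ n = tvar ^- (k - n).
  move=> le_nk; rewrite -[in LHS](subnK le_nk) exprD invfM -mulrA mulVf ?mulr1 //.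
  by rewrite expf_neq0 ?tvar_neq0.
pose G n := (catalan n * tvar ^- (k - n)) *: xvar ^+ n.
have -> : tvar ^- k *: \sum_(0 <= n < k) catalan n *: (tvar *: xvar) ^+ n =
    \sum_(0 <= n < k) G n.
  rewrite scaler_sumr; apply: eq_big_nat => n /andP[_ lt_nk].
  by rewrite exprZn !scalerA [tvar ^- k * _]mulrC -mulrA tX 1?ltnW.
have G0 : tvar ^- k *: 1 = G 0%N by rewrite /G catalan0 mul1r subn0 expr0.
have Gk : catalan k *: xvar ^+ k = G k by rewrite /G subnn expr0 invr1 mulr1.
have GE : \sum_(0 <= n < k) G n = G 0%N + \sum_(0 <= n < k) G n.+1 - G k.
  by rewrite -big_nat_recl // big_nat_recr //= addrK.
by rewrite G0 Gk GE; ring.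
Qed.

Lemma fps_coef_beta (k n : nat) : fps_coef (beta k.+1) n =
  if (n < k)%N then tvar ^- k * (catalan n * tvar ^+ n) - catalan n else 0.
Proof.
rewrite /beta -[k.+1.-1]/k.
have -> : tvar ^- k *: (\sum_(0 <= m < k) catalan m *: (tvar *: xvar) ^+ m) =
    tvar ^- k *: \sum_(0 <= m < k) (catalan m * tvar ^+ m) *: xvar ^+ m.
  by apply: congr1; apply: eq_bigr => m _; rewrite exprZn scalerA.
have coefE (f g : fps Qt) : fps_coef (- f + tvar ^- k *: g) n =
    tvar ^- k * fps_coef g n - fps_coef f n by exact: addrC.
rewrite coefE !fps_coef_sum_varX.
by case: ifP => _ //; rewrite mulr0 subr0.
Qed.

(** * The functional equation *)

(** For n < k + 1 the bottom row holds no rectangle, so q_n = p_n and the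
    first-return recurrence is the Catalan one. *)
Lemma occ_poly_catalan (k n : nat) : (n <= k)%N -> occ_poly k.+1 n = catalan n.
Proof.
elim/ltn_ind: n => -[|n] IHn le_nk; rewrite occ_poly_bottom.
  by rewrite above_poly0 catalan0 mulr1.
rewrite (eqP le_nk) mul1r above_polyS catalan_rec; apply: eq_bigr => i _.
have le_in := leq_ord i; have le_k j : (j <= n)%N -> (j <= k)%N by lia.
rewrite IHn ?le_k //; congr (_ * _).
have := IHn (n - i)%N; rewrite occ_poly_bottom.
rewrite (eqP (le_k _ (leq_subr i n))) mul1r; apply; last exact/le_k/leq_subr.
by rewrite ltnS leq_subr.
Qed.

(** For n >= k, p_n = t^(n-k) q_n is the coefficient of t^-k Q(t x).  For n < k
    that coefficient is t^(n-k) C_n, which exceeds p_n = C_n by the coefficient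
    of beta. *)
Lemma occ_series_above (k : nat) :
  occ_series k.+1 =
  tvar ^- k *: fps_dilate tvar (Fps (above_poly k.+1)) - beta k.+1.
Proof.
apply/fpsP => n.
rewrite -[RHS]/(tvar ^- k * (tvar ^+ n * above_poly k.+1 n)
  - fps_coef (beta k.+1) n) fps_coef_beta -[LHS]/(occ_poly k.+1 n).
case: ltnP => [lt_nk|le_kn].
  have := occ_poly_catalan _ _ (ltnW lt_nk); rewrite occ_poly_bottom.
  have /eqP -> := ltnW lt_nk; rewrite mul1r => ->; ring.
have -> : tvar ^+ n = tvar ^+ k * tvar ^+ (n - k) by rewrite -exprD subnKC.
by rewrite subr0 occ_poly_bottom -mulrA mulKf ?expf_neq0 ?tvar_neq0.
Qed.

(** The first-return recurrence (1 - x P(x)) Q(x) = 1, at t x in place of x. *)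
Lemma above_series_inv (k : nat) :
  (1 - tvar *: xvar * fps_dilate tvar (occ_series k.+1))
    * fps_dilate tvar (Fps (above_poly k.+1)) = 1.
Proof.
rewrite mulrBl mul1r; apply/eqP; rewrite subr_eq; apply/eqP/fpsP => n.
rewrite -!scalerAl -mulrA.
set PQ := fps_dilate _ _ * fps_dilate _ _.
rewrite -[RHS]/((n == 0)%:R + tvar * fps_coef (xvar * PQ) n) fps_coef_varM.
case: n => [|n] /=; first by rewrite mulr0 addr0 above_poly0 mulr1.
rewrite add0r above_polyS !mulr_sumr; apply: eq_bigr => i _.
have := leq_ord i; rewrite /= => le_in.
by rewrite exprS -{1}(subnKC le_in) exprD; ring.
Qed.

Theorem theorem7 (s : nat) (hs : (1 <= s)%N) :
  occ_series s =
    (alpha s + beta s * (tvar *: xvar * fps_dilate tvar (occ_series s)))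
    / (1 - tvar *: xvar * fps_dilate tvar (occ_series s)).
Proof.
case: s hs => // k _.
have := above_series_inv k; have := occ_series_above k.
set D := tvar *: xvar * _; set Q := fps_dilate _ (Fps _) => PE DQ.
have uD : (1 - D) \is a GRing.unit.
  by apply/unitrP; exists Q; rewrite mulrC DQ.
apply: (mulIr uD); rewrite divrK // PE.
rewrite mulrBl -scalerAl [Q * _]mulrC DQ -alphaD_beta; ring.
Qed.
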